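(* Let $G$ be a finite commutative group with $|G|=q$, and let $c,\rho$ be real numbers with \[ 1<c<\frac{q}{32\log q},\qquad 16c\frac{\log q}{q}<\rho<1-16c\frac{\log q}{q}. \] Then with probability exceeding $1-2q^{1-c}$ the random standard set $R$ corresponding to probability $\rho$ satisfies \[ \bigl||R|-\rho q\bigr|<3\sqrt{c\rho(1-\rho)q\log q} \] and \[ \frac{1}{3\sqrt{c\log q}}\sqrt{\frac{1-\rho}{\rho q}}<\lambda^-(R)\le\lambda^+(R)<3\sqrt{c\log q}\sqrt{\frac{1-\rho}{\rho q}}. \]
   Context: $G$ is written additively; $\log$ is the natural logarithm. A set $A\subset G$ is a standard set if $A=-A$ and $0\in A$. Random standard set: let $G_1=\{x\in G:2x=0\}$ and let $G_2$ be a set containing exactly one element of each pair $\{x,-x\}$ partitioning $G\setminus G_1$. Let $\{\xi_y: y\in G_1\cup G_2\}$ be independent $\{0,1\}$-valued random variables with $\Pr(\xi_y=1)=\rho$. The random standard set corresponding to probability $\rho$ is $R=\{0\}\cup\{y\in G_1:\xi_y=1\}\cup\bigcup_{y\in G_2,\ \xi_y=1}\{y,-y\}$. A character of $G$ is a homomorphism $\gamma:G\to\{z\in\mathbb C:|z|=1\}$; $\hat G$ is the group of characters and $\mathbf 1$ the principal character. For $f:G\to\mathbb R$, $\hat f(\gamma)=\sum_{x\in G}\gamma(x)f(x)$. For a standard set $A$: $\mathcal S^-(A)$ is the set of $f:G\to\mathbb R$, not identically zero, with $f\le 0$ on $G\setminus A$; $\mathcal S^+(A)$ the set of such $f$ with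 $f=0$ on $G\setminus A$ and $f\ge0$ on $A$; $\lambda^-(A)=\min\{f(0)/\hat f(\mathbf 1): f\in\mathcal S^-(A),\ \hat f\ge0\text{ on }\hat G\}$ and $\lambda^+(A)$ likewise with $\mathcal S^+(A)$. *)

(* Defs.v *)
From HB Require Import structures.
From mathcomp Require Import all_boot all_order all_algebra.
From mathcomp Require Import complex.
From mathcomp Require Import all_classical all_reals all_analysis.

Set Implicit Arguments.
Unset Strict Implicit.
Unset Printing Implicit Defensive.

Import Order.TTheory GRing.Theory Num.Theory.
Local Open Scope ring_scope.
Local Open Scope complex_scope.

Section RandomStandardSet.
Variable G : finZmodType.

Definition standard (A : {set G}) : Prop :=
  (forall x, (- x \in A) = (x \in A)) /\ 0 \in A.

Definition involutions : {set G} := [set x | x *+ 2 == 0].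

(* Outside involutions we have x != - x, so the exclusive or selects exactly
   one element of the two-element set {x, - x}. *)
Definition pair_representatives (G2 : {set G}) : Prop :=
  [disjoint G2 & involutions] /\
  forall x, x \notin involutions -> (x \in G2) (+) (- x \in G2).

Definition std_set_of (G2 : {set G}) (xi : G -> bool) : {set G} :=
  [set 0] :|: [set y in involutions | xi y]
          :|: \bigcup_(y in G2 | xi y) [set y; - y].

Lemma std_set_of_standard (G2 : {set G}) (xi : G -> bool) :
  standard (std_set_of G2 xi).
Proof.
suff H x : x \in std_set_of G2 xi -> - x \in std_set_of G2 xi.
  split=> [x|]; last by rewrite !inE eqxx.
  by apply/idP/idP => /H; rewrite ?opprK.
rewrite !inE => /orP[/orP[/eqP->|/andP[x2 xix]]|/bigcupP[y yG2]].
- by rewrite oppr0 eqxx.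
- have -> : - x = x by apply/esym/eqP; rewrite -addr_eq0 -mulr2n.
  by rewrite x2 xix orbT.
- by rewrite !inE => /orP[]/eqP->; apply/orP; right; apply/bigcupP; exists y;
    rewrite // !inE ?opprK eqxx ?orbT.
Qed.

End RandomStandardSet.

Local Open Scope classical_set_scope.

Section Lambda.
Variables (R : realType) (G : finZmodType).

Definition character (gam : G -> R[i]) : Prop :=
  (forall x y, gam (x + y) = gam x * gam y) /\ (forall x, `|gam x| = 1).

Definition principal : G -> R[i] := fun=> 1.

Definition fourier (f : G -> R) (gam : G -> R[i]) : R[i] :=
  \sum_(x : G) gam x * (f x)%:C.

Definition Sminus (A : {set G}) : set (G -> R) :=
  [set f | (exists x, f x != 0) /\ (forall x, x \notin A -> f x <= 0)].

Definition Splus (A : {set G}) : set (G -> R) :=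
  [set f | [/\ exists x, f x != 0,
               forall x, x \notin A -> f x = 0 &
               forall x, x \in A -> 0 <= f x]].

(* In R[i], 0 <= z means that z is real and nonnegative.  The quotient
   f(0) / f^(1) is only meaningful when f^(1) != 0 (when f^(1) = 0 it is to be
   read as +oo, since then f(0) > 0, and does not compete for the minimum);
   this has to be required explicitly because x / 0 = 0 here. *)
Definition quotients (S : set (G -> R)) : set R :=
  [set r | exists f, [/\ S f,
                         forall gam, character gam -> 0 <= fourier f gam,
                         fourier f principal != 0 &
                         r%:C = (f 0)%:C / fourier f principal]].

(* The least element of B, and 0 when B has none. *)
Definition minimum (B : set R) : R := xget 0 (B `&` lbound B).

Definition lambda_minus (A : {set G}) : R := minimum (quotients (Sminus A)).
Definition lambda_plus (A : {set G}) : R := minimum (quotients (Splus A)).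

End Lambda.

Definition mutually_independent (d d' : measure_display) (T : measurableType d)
    (T' : measurableType d') (R : realType) (P : probability T R)
    (I : finType) (D : {set I}) (X : I -> {RV P >-> T'}) : Prop :=
  forall (J : {set I}) (B : I -> set T'),
    J \subset D -> (forall i, i \in J -> measurable (B i)) ->
    P (\bigcap_(i in [set` J]) (X i @^-1` B i)) =
      (\prod_(i in J) P (X i @^-1` B i))%E.

(* Main.v *)
(* Write [t0 = 3 sqrt (c rho (1 - rho) q log q)].  For a character [gam] the sum of
   [gam] over the random set R is 1 plus a sum of independent variables; call its
   deviation from the mean the discrepancy of R at [gam].  A Chernoff bound, together
   with the union bound over the q characters, shows that with the required probability
   every discrepancy is smaller than [t0 - 1] in absolute value.

   On this event the conclusion is deterministic.  The principal character gives the
   size of R.  The functions [1_R + K delta_0] and [1_{G \ R} + K' delta_0], with [K] and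
   [K'] just large enough to make the Fourier transforms nonnegative, bound
   [lambda_plus R] from above directly and [lambda_minus R] from below through the
   Parseval duality [q f(0) g(0) >= f^(1) g^(1)].  Both minima are attained because a
   positive definite function is bounded by its value at 0, so that the normalised
   competitors form a compact set. *)
Require Import Defs.
From HB Require Import structures.
From mathcomp Require Import all_boot all_order all_algebra.
From mathcomp Require Import fingroup finalg cyclic cyclotomic separable complex.
From mathcomp Require Import ring lra.
From mathcomp Require Import all_classical all_reals all_analysis.
Import Order.TTheory GRing.Theory Num.Theory.
Import numFieldNormedType.Exports.
Local Open Scope ring_scope.
Local Open Scope classical_set_scope.

Local Notation Re := complex.Re.
Local Notation Im := complex.Im.

(** * Characters of a finite commutative group *)

Section Dual.
Variables (R : realType) (G : finZmodType).

Lemma card_zmod_gt0 : (0 < #|G|)%N.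
Proof. by apply/card_gt0P; exists 0. Qed.

(** Translation by [x] in the regular representation. The size has the form [n.+1] so that square
    matrices form a ring. *)
Definition shift_mx n (e : 'I_n.+1 -> G) (x : G) : 'M[R[i]]_n.+1 :=
  \matrix_(i, j) (e i + x == e j)%:R.

Lemma shift_mxD n (e : 'I_n.+1 -> G) x y : bijective e ->
  shift_mx n e (x + y) = shift_mx n e x * shift_mx n e y.
Proof.
case=> r er re; apply/matrixP => i j; rewrite !mxE.
rewrite (bigD1 (r (e i + x))) //= !mxE re eqxx mul1r addrA big1 ?addr0 // => k kr.
rewrite !mxE; case: eqP => [E|_]; last by rewrite mul0r.
by rewrite E er eqxx in kr.
Qed.

Lemma shift_mx0 n (e : 'I_n.+1 -> G) : bijective e -> shift_mx n e 0 = 1.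
Proof.
by move=> /bij_inj ei; apply/matrixP => i j; rewrite !mxE addr0 (inj_eq ei).
Qed.

Lemma shift_mxX n (e : 'I_n.+1 -> G) x k : bijective e ->
  shift_mx n e x ^+ k = shift_mx n e (x *+ k).
Proof.
move=> be; elim: k => [|k IH]; first by rewrite expr0 mulr0n shift_mx0.
by rewrite exprS IH mulrS shift_mxD.
Qed.

Lemma zmod_mulr_card (x : G) : x *+ #|G| = 0.
Proof.
have /= := @expg_cardG G [set: G]%G x (finset.in_setT x).
by rewrite cardsT FinRing.zmodXgE.
Qed.

(** [A] is annihilated by [X^m - 1], which splits into distinct linear factors in characteristic
    0. *)
Lemma diagonalizable_root_of_1 n (A : 'M[R[i]]_n.+1) m : (0 < m)%N ->
  A ^+ m = 1 -> diagonalizable A.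
Proof.
move=> m0 Am; apply/diagonalizableP.
have [rs rsE] := closed_field_poly_normal ('X^m - 1 : {poly R[i]}).
have lc : lead_coef ('X^m - 1 : {poly R[i]}) = 1.
  by apply/eqP; rewrite -monicE monicXnsubC.
rewrite lc scale1r in rsE.
exists rs.
  rewrite -separable_prod_XsubC -rsE separable_Xn_sub_1 //.
  by rewrite pnatr_eq0 -lt0n.
rewrite -rsE mxminpoly_min // rmorphB rmorph1 /= rmorphXn /= horner_mx_X Am.
by rewrite subrr.
Qed.

(** An enumeration of the dual group, so that sums over characters become finite sums; the second
    condition is column orthogonality. *)
Definition dual_family (chi : 'I_#|G| -> G -> R[i]) :=
  (forall i, character (chi i)) /\
  forall x, \sum_i chi i x = if x == 0 then #|G|%:R else 0.

(* The translations of C[G] commute and have finite order; a common eigenbasis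
   carries the characters, and the trace of a translation is the sum of their
   values. *)
Lemma exists_dual_family : exists chi, dual_family chi.
Proof.
have [n nE] : exists n, #|G| = n.+1.
  by exists #|G|.-1; rewrite prednK // card_zmod_gt0.
have [e be] : exists e : 'I_n.+1 -> G, bijective e.
  rewrite -nE; exists enum_val; exists enum_rank; [exact: enum_valK|exact: enum_rankK].
pose S := shift_mx n e.
have [P Pu /allP PD] : codiagonalizable [seq S x | x <- enum G].
  apply/codiagonalizableP; split=> [A B|A].
    move=> /mapP[x _ ->] /mapP[y _ ->]; rewrite /comm_mx.
    by have := shift_mxD n e x y be; rewrite addrC shift_mxD //; exact.
  move=> /mapP[x _ ->]; apply: (@diagonalizable_root_of_1 _ _ #|G|).
    exact: card_zmod_gt0.
  by rewrite shift_mxX // zmod_mulr_card shift_mx0.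
pose T x := P *m S x *m invmx P.
have TD x : is_diag_mx (T x).
  have /PD : S x \in [seq S x | x <- enum G] by apply: map_f; rewrite mem_enum.
  by rewrite -[T x]conjumx.
have TM x y : T (x + y) = T x * T y.
  rewrite /T /S shift_mxD // /GRing.mul /=.
  by rewrite !mulmxA -[_ *m invmx P *m P]mulmxA mulVmx // mulmx1.
have T0 : T 0 = 1 by rewrite /T /S shift_mx0 // mulmx1 mulmxV.
pose chi (i : 'I_n.+1) x := T x i i.
have chiM i x y : chi i (x + y) = chi i x * chi i y.
  rewrite /chi TM mxE (bigD1 i) //= big1 ?addr0 // => k ki.
  by move/is_diag_mxP: (TD x) => /(_ i k); rewrite eq_sym => /(_ ki) ->; rewrite mul0r.
have chi0 i : chi i 0 = 1 by rewrite /chi T0 mxE eqxx.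
have chiX i x k : chi i (x *+ k) = chi i x ^+ k.
  elim: k => [|k IH]; first by rewrite mulr0n expr0 chi0.
  by rewrite mulrS chiM IH exprS.
have tr x : \sum_i chi i x = if x == 0 then #|G|%:R else 0.
  transitivity (\tr (T x)); first by [].
  rewrite /T mxtrace_mulC mulmxA mulVmx // mul1mx.
  case: eqP => [->|/eqP x0]; first by rewrite /S shift_mx0 // mxtrace1 nE.
  rewrite /mxtrace big1 // => i _; rewrite mxE -subr_eq0 addrAC subrr add0r.
  by rewrite (negPf x0).
clearbody chi; move: chi chiM chi0 chiX tr; rewrite -nE => chi chiM chi0 chiX tr.
exists chi; split=> // i; split=> // x.
apply/eqP; rewrite -(@pexpr_eq1 _ _ #|G|) ?card_zmod_gt0 //.
by rewrite -normrX -chiX zmod_mulr_card chi0 normr1.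
Qed.

End Dual.

(** * Fourier transform, Parseval and positive definite functions *)

Section Fourier.
Local Open Scope complex_scope.
Local Open Scope classical_set_scope.
Variables (R : realType) (G : finZmodType).
Implicit Types (gam : G -> R[i]) (f g : G -> R).

Lemma character0 gam : character gam -> gam 0 = 1.
Proof.
move=> [gM gN]; have g0 : gam 0 != 0 by rewrite -normr_eq0 gN oner_eq0.
by apply: (mulfI g0); rewrite -gM addr0 mulr1.
Qed.

Lemma characterN gam x : character gam -> gam (- x) = (gam x)^*.
Proof.
move=> cg; have [gM gN] := cg.
have gx : gam x != 0 by rewrite -normr_eq0 gN oner_eq0.
by apply: (mulfI gx); rewrite -gM subrr character0 // -sqr_normc gN expr1n.
Qed.

Lemma character_Re_le1 gam x : character gam -> `|Re (gam x)| <= 1.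
Proof.
by move=> [_ gN]; rewrite -lecR rmorph1 -(gN x) normc_ge_Re.
Qed.

Lemma character_ReN gam x : character gam -> Re (gam (- x)) = Re (gam x).
Proof. by move=> cg; rewrite characterN //; case: (gam x). Qed.

(** Translating the summation variable by some [y] with [gam y != 1] multiplies the sum by
    [gam y]. *)
Lemma character_sum gam : character gam -> gam <> @principal R G ->
  \sum_x gam x = 0.
Proof.
move=> [gM gN] gne.
have [y gy] : exists y, gam y != 1.
  apply: contrapT => /forallNP H; apply: gne; apply/funext => x.
  by apply/eqP; rewrite -[_ == _]negbK; apply/negP/H.
have E : \sum_x gam x = gam y * \sum_x gam x.
  rewrite [LHS](reindex_inj (addrI y)) mulr_sumr.
  by apply: eq_bigr => x _; rewrite gM.
apply/eqP; move/eqP: E; rewrite -subr_eq0 -{1}[\sum_x _]mul1r -mulrBl.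
by rewrite mulf_eq0 subr_eq0 eq_sym (negPf gy).
Qed.

Lemma character_Re_sum gam : character gam -> gam <> @principal R G ->
  \sum_x Re (gam x) = 0.
Proof.
move=> cg gne; have /(congr1 (@Re R)) := character_sum gam cg gne.
by rewrite /= raddf_sum.
Qed.

Lemma principal_character : character (@principal R G).
Proof. by split=> *; rewrite ?mulr1 ?normr1. Qed.

Lemma fourier_principal f : fourier f (@principal R G) = (\sum_x f x)%:C.
Proof.
by rewrite /fourier rmorph_sum; apply: eq_bigr => x _; rewrite mul1r.
Qed.

Lemma fourier_Re f gam : Re (fourier f gam) = \sum_x Re (gam x) * f x.
Proof.
rewrite /fourier raddf_sum; apply: eq_bigr => x _.
by case: (gam x) => a b /=; rewrite mulr0 subr0.
Qed.

Lemma fourier_Im f gam : Im (fourier f gam) = \sum_x Im (gam x) * f x.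
Proof.
rewrite /fourier raddf_sum; apply: eq_bigr => x _.
by case: (gam x) => a b /=; rewrite mulr0 add0r.
Qed.

Lemma fourier_ge0 f gam : (0 <= fourier f gam) =
  (\sum_x Im (gam x) * f x == 0) && (0 <= \sum_x Re (gam x) * f x).
Proof. by rewrite lecE fourier_Im fourier_Re. Qed.

Lemma fourier_even f gam : character gam -> (forall x, f (- x) = f x) ->
  fourier f gam = (\sum_x Re (gam x) * f x)%:C.
Proof.
move=> cg fe; apply/eqP; rewrite eq_complex fourier_Re fourier_Im /= eqxx /=.
suff : \sum_x Im (gam x) * f x = - \sum_x Im (gam x) * f x.
  by move=> E; apply/eqP; lra.
rewrite {1}(reindex_inj oppr_inj) -sumrN; apply: eq_bigr => x _.
by rewrite fe characterN // -mulNr; case: (gam x).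
Qed.

(** By Bochner's theorem these are the positive definite functions. *)
Definition posdef f := forall gam, character gam -> 0 <= fourier f gam.

(** A character missing from the family would be orthogonal to each [chi i], but summing these inner
    products over [i] gives [#|G|] by column orthogonality. *)
Lemma dual_family_all chi gam : dual_family R G chi -> character gam ->
  exists i, chi i = gam.
Proof.
move=> [cchi schi] cg; apply: contrapT => /forallNP H.
have : \sum_i \sum_x (gam x)^* * chi i x = 0.
  rewrite big1 // => i _.
  have [cM cN] := cchi i; have [gM gN] := cg.
  apply: (@character_sum (fun x => (gam x)^* * chi i x)).
    split=> [x y|x]; first by rewrite gM cM rmorphM mulrACA.
    by rewrite normrM normcJ gN cN mulr1.
  move=> E; apply: (H i); apply/funext => x; have /= := congr1 (@^~ x) E.
  move=> /(congr1 (fun z => gam x * z)); rewrite /principal mulr1 mulrA.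
  by rewrite -sqr_normc gN expr1n mul1r.
rewrite exchange_big /=.
under eq_bigr do rewrite -mulr_sumr schi.
rewrite (bigD1 0) //= eqxx big1 => [|x /negPf ->]; last by rewrite mulr0.
rewrite addr0 character0 // rmorph1 mul1r => /eqP; rewrite pnatr_eq0.
by rewrite -leqn0 leqNgt card_zmod_gt0.
Qed.

(** After expansion the sum over [i] acts on [chi i (x - y)], and column orthogonality keeps only
    the diagonal [x = y]. *)
Lemma parseval chi f g : dual_family R G chi ->
  \sum_i fourier f (chi i) * (fourier g (chi i))^* =
  (#|G|%:R * \sum_x f x * g x)%:C.
Proof.
move=> [cchi schi].
transitivity (\sum_i \sum_x \sum_y (f x * g y)%:C * chi i (x - y)).
  apply: eq_bigr => i _; rewrite /fourier rmorph_sum mulr_suml.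
  apply: eq_bigr => x _; rewrite mulr_sumr; apply: eq_bigr => y _.
  have [cM _] := cchi i; rewrite cM characterN // !rmorphM /=.
  rewrite -[Num.conj (g y)%:C]/(conjc _) conjc_real.
  by rewrite mulrACA [LHS]mulrC.
rewrite exchange_big /= mulr_sumr rmorph_sum; apply: eq_bigr => x _.
rewrite exchange_big /=; under eq_bigr do rewrite -mulr_sumr schi.
rewrite (bigD1 x) //= subrr eqxx big1 => [|y yx].
  by rewrite addr0 [RHS]rmorphM mulrC rmorph_nat.
by rewrite subr_eq0 eq_sym (negPf yx) mulr0.
Qed.

Lemma fourier_delta (y : G) gam : fourier (fun x => (x == y)%:R) gam = gam y.
Proof.
rewrite /fourier (bigD1 y) //= eqxx mulr1 big1 ?addr0 // => x /negPf ->.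
by rewrite mulr0.
Qed.

(** In the inversion formula the coefficients are nonnegative, so the triangle inequality bounds
    every value by the one at 0. *)
Lemma posdef_le0 f x : posdef f -> `|f x| <= f 0.
Proof.
move=> pf; have [chi dchi] := exists_dual_family R G.
(* Fourier inversion is Parseval against a point mass at [y]. *)
have inv y : \sum_i fourier f (chi i) * (chi i y)^* = (#|G|%:R * f y)%:C.
  under eq_bigr do rewrite -fourier_delta.
  rewrite parseval // (bigD1 y) //= eqxx mulr1 big1 ?addr0 // => z /negPf ->.
  by rewrite mulr0.
have q0 : 0 < #|G|%:R :> R by rewrite ltr0n card_zmod_gt0.
rewrite -(ler_pM2l q0) -lecR -inv -[X in X * `|_|](gtr0_norm q0) -normrM.
have [cchi _] := dchi.
have normcR (a : R) : `|a|%:C = `|a%:C|.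
  by rewrite normc_def /= expr0n addr0 sqrtr_sqr.
rewrite normcR -inv; apply: le_trans (ler_norm_sum _ _ _) _.
apply: ler_sum => i _; have [_ cN] := cchi i.
rewrite normrM normcJ cN mulr1 ger0_norm; last exact: pf.
by rewrite character0 // rmorph1 mulr1.
Qed.

(** All terms of the Parseval sum are nonnegative, and the left side is the term of the principal
    character. *)
Lemma posdef_mul_sum f g : posdef f -> posdef g ->
  (\sum_x f x) * (\sum_x g x) <= #|G|%:R * \sum_x f x * g x.
Proof.
move=> pf pg; have [chi dchi] := exists_dual_family R G.
rewrite -lecR -(parseval chi) //.
have [i iE] := dual_family_all chi _ dchi principal_character.
rewrite (bigD1 i) //= iE !fourier_principal.
rewrite -[Num.conj (\sum_x g x)%:C]/(conjc _) conjc_real -rmorphM lerDl.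
apply: sumr_ge0 => j _; have [cchi _] := dchi.
by rewrite mulr_ge0 ?conj_ge0 ?pf ?pg.
Qed.

(** The transform at the principal character is real and nonnegative here, so nonzero means positive
    and the complex quotient is a real one. *)
Lemma quotientsP (S : set (G -> R)) r : quotients S r <->
  exists f, [/\ S f, posdef f, 0 < \sum_x f x & r = f 0 / \sum_x f x].
Proof.
split=> -[f [Sf pf f1 rE]]; exists f; rewrite ?fourier_principal in f1 rE *.
  split=> //.
    rewrite lt0r; have := pf _ principal_character.
    by rewrite fourier_principal ler0c => ->; rewrite andbT; move: f1; rewrite fmorph_eq0.
  by apply: complexI; rewrite rE fmorph_div.
split=> //; first by rewrite fmorph_eq0 gt_eqF.
by rewrite rE fmorph_div.
Qed.

End Fourier.

(** * Attainment and duality of the two minima *)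

Section Minimum.
Local Open Scope complex_scope.
Local Open Scope classical_set_scope.
Variables (R : realType) (G : finZmodType).
(** The product topology is the one to which Tychonoff's theorem applies. *)
Let E := prod_topology (fun _ : G => R).

Lemma linear_form_continuous (a : G -> R) :
  continuous (fun f : E => \sum_x a x * f x).
Proof.
move=> f.
have c (x : G) : (a x * (h : E) x) @[h --> f] --> a x * f x.
  apply: (@cvg_comp E R R (@^~ x) ( *%R (a x)) (nbhs f) (nbhs (f x))).
    exact: (@proj_continuous G (fun _ => R) x f).
  exact: mulrl_continuous.
apply: (@cvg_big R G +%R 0 xpredT _ E (nbhs f) (index_enum G)
  (fun x (h : E) => a x * h x) (fun x => a x * f x)) => // z.
exact: add_continuous.
Qed.

Lemma closed_linear_form_le (a : G -> R) b :
  closed [set f : E | \sum_x a x * f x <= b].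
Proof.
apply: (@closed_comp E R (fun f => \sum_x a x * f x) [set y | y <= b]).
  by move=> f _; exact: linear_form_continuous.
exact: closed_le.
Qed.

Lemma closed_coord_le (x : G) b : closed [set f : E | f x <= b].
Proof.
apply: (@closed_comp E R (@^~ x) [set y | y <= b]) => [f _|].
  exact: (@proj_continuous G (fun _ => R) x f).
exact: closed_le.
Qed.

Lemma closed_coord_ge (x : G) b : closed [set f : E | b <= f x].
Proof.
apply: (@closed_comp E R (@^~ x) [set y | b <= y]) => [f _|].
  exact: (@proj_continuous G (fun _ => R) x f).
exact: closed_ge.
Qed.

Lemma closed_linear_form_ge (a : G -> R) b :
  closed [set f : E | b <= \sum_x a x * f x].
Proof.
apply: (@closed_comp E R (fun f => \sum_x a x * f x) [set y | b <= y]).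
  by move=> f _; exact: linear_form_continuous.
exact: closed_ge.
Qed.

(** Each character imposes three closed linear inequalities: two make the imaginary part vanish, one
    makes the real part nonnegative. *)
Lemma closed_posdef : closed [set f : E | posdef R G f].
Proof.
rewrite (_ : mkset _ = \bigcap_(gam in [set gam | @character R G gam])
    ([set f : E | \sum_x Im (gam x) * f x <= 0] `&`
     [set f : E | 0 <= \sum_x Im (gam x) * f x] `&`
     [set f : E | 0 <= \sum_x Re (gam x) * f x])); last first.
  apply/seteqP; split=> f /= H gam cg; have := H gam cg;
    rewrite fourier_ge0 eq_le => /=; first by move=> /andP[/andP[-> ->] ->].
  by move=> [[-> ->] ->].
apply: closed_bigI => gam _; apply: closedI; first apply: closedI.
- exact: closed_linear_form_le.
- exact: closed_linear_form_ge.
- exact: closed_linear_form_ge.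
Qed.

Definition delta0 : G -> R := fun x => (x == 0)%:R.

Lemma sum_delta0 : \sum_x delta0 x = 1.
Proof.
by rewrite (bigD1 0) //= /delta0 eqxx big1 ?addr0 // => x /negPf ->.
Qed.

Lemma posdef_delta0 : posdef R G delta0.
Proof. by move=> gam cg; rewrite fourier_delta character0. Qed.

Lemma posdef_scale f a : 0 <= a -> posdef R G f -> posdef R G (fun x => a * f x).
Proof.
move=> a0 pf gam cg; rewrite (_ : fourier _ _ = a%:C * fourier f gam).
  by rewrite mulr_ge0 ?ler0c ?pf.
by rewrite /fourier mulr_sumr; apply: eq_bigr => x _; rewrite rmorphM mulrCA.
Qed.

(* The functions normalised by [\sum_x f x = 1] and [f 0 <= 1] form a compact
   set, since a positive definite function is bounded by its value at 0. *)
Lemma quotients_has_minimum (C : set (G -> R)) :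
  closed (C : set E) -> C delta0 ->
  (forall f a, 0 < a -> C f -> C (fun x => a * f x)) ->
  let S := [set f | (exists x, f x != 0) /\ C f] in
  quotients S (minimum (quotients S)) /\
  lbound (quotients S) (minimum (quotients S)).
Proof.
move=> clC Cd CZ S.
suff [r [Sr lr]] : exists r, quotients S r /\ lbound (quotients S) r.
  by have [] : (quotients S `&` lbound (quotients S)) (minimum (quotients S));
    [apply: xgetPex; exists r|].
have sE (f : G -> R) : \sum_x f x = \sum_x 1 * f x.
  by apply: eq_bigr => x _; rewrite mul1r.
pose K : set E := [set f | forall x, `[-1, 1] (f x)] `&`
  (C `&` [set f : E | posdef R G f] `&`
   ([set f : E | \sum_x 1 * f x <= 1] `&` [set f : E | 1 <= \sum_x 1 * f x])).
have KP (f : E) : K f <-> [/\ C f, posdef R G f, \sum_x f x = 1 & f 0 <= 1].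
  split=> [[fI [[Cf pf] [s1 s2]]]|[Cf pf s1 f0]].
    split=> //; first by apply/eqP; rewrite eq_le sE; apply/andP; split.
    by have := fI 0; rewrite /= in_itv /= => /andP[].
  split; last by split=> //; split; rewrite /= -sE s1.
  move=> x /=; rewrite in_itv /= -ler_norml.
  exact: le_trans (posdef_le0 _ _ _ _ pf) f0.
have cK : compact K.
  apply: compact_closedI.
    apply: (@tychonoff G (fun _ => R) (fun _ => `[-1, 1])) => _.
    exact: segment_compact.
  apply: closedI; first by apply: closedI => //; exact: closed_posdef.
  by apply: closedI; [exact: closed_linear_form_le|exact: closed_linear_form_ge].
have nK : K !=set0.
  exists delta0; apply/KP; split=> //.
  - exact: posdef_delta0.
  - exact: sum_delta0.
  - by rewrite /delta0 eqxx.
have [f /set_mem/KP[Cf pf sf f01] fmin] :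
    exists2 c : E, c \in K & forall t : E, t \in K -> c 0 <= t 0.
  apply: (@compact_EVT_min E R (@^~ 0)) => //.
  apply: continuous_subspaceT => g.
  exact: (@proj_continuous G (fun _ => R) 0 g).
exists (f 0); split.
  apply/quotientsP; exists f; split=> //; last by rewrite sf divr1.
    (* Being nonzero is not a closed condition; it is recovered from the normalisation of the sum to
       1. *)
    split=> //; apply: contrapT => /forallNP H.
    move: sf; rewrite big1 => [/eqP|x _]; first by rewrite eq_sym oner_eq0.
    by apply/eqP; rewrite -[_ == _]negbK; apply/negP/H.
  by rewrite sf.
move=> _ /quotientsP[g [[_ Cg] pg sg ->]].
(* A quotient above 1 already exceeds [f 0]; otherwise rescaling [g] to sum 1 gives a point of
   [K]. *)
have [le1|/ltW gt1] := leP (g 0 / \sum_x g x) 1; last exact: le_trans f01 gt1.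
have sg' : 0 < (\sum_x g x)^-1 by rewrite invr_gt0.
rewrite mulrC; apply: (fmin (fun x => (\sum_x g x)^-1 * g x)).
apply/mem_set/KP; split; first exact: CZ.
- by apply: posdef_scale => //; exact: ltW.
- by rewrite -mulr_sumr mulVf // gt_eqF.
- by rewrite mulrC.
Qed.

Lemma lambda_minusP (A : {set G}) : 0 \in A ->
  quotients (@Sminus R G A) (lambda_minus R A) /\
  lbound (quotients (@Sminus R G A)) (lambda_minus R A).
Proof.
move=> A0; apply: (@quotients_has_minimum
    [set f | forall x, x \notin A -> f x <= 0]).
- rewrite (_ : mkset _ = \bigcap_(x in [set x | x \notin A])
      [set f : E | f x <= 0]) //.
  by apply: closed_bigI => x _; exact: closed_coord_le.
- move=> x /= xA; rewrite /delta0; case: eqP => // x0.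
  by rewrite x0 A0 in xA.
- by move=> f a a0 Cf x /Cf fx; rewrite pmulr_rle0.
Qed.

(** Writing the constraints as weak inequalities, closed and stable under positive scaling, gives
    the shape required by [quotients_has_minimum]. *)
Lemma SplusE (A : {set G}) : @Splus R G A = [set f | (exists x, f x != 0) /\
  (forall x, (x \notin A -> f x <= 0) /\ 0 <= f x)].
Proof.
apply/seteqP; split=> f /=.
  move=> [nz f0 fp]; split=> // x; split=> [/f0 -> //|].
  by have [/fp//|/f0 ->] := boolP (x \in A).
move=> [nz H]; split=> // x xA; last by have [] := H x.
by have [h1 h2] := H x; apply/eqP; rewrite eq_le h1.
Qed.

Lemma lambda_plusP (A : {set G}) : 0 \in A ->
  quotients (@Splus R G A) (lambda_plus R A) /\
  lbound (quotients (@Splus R G A)) (lambda_plus R A).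
Proof.
move=> A0; rewrite /lambda_plus SplusE; apply: (@quotients_has_minimum
    [set f | forall x, (x \notin A -> f x <= 0) /\ 0 <= f x]).
- rewrite (_ : mkset _ =
    (\bigcap_(x in [set x | x \notin A]) [set f : E | f x <= 0]) `&`
    (\bigcap_(x in [set: G]) [set f : E | 0 <= f x])).
    apply: closedI; apply: closed_bigI => x _; first exact: closed_coord_le.
    exact: closed_coord_ge.
  apply/seteqP; split=> [f H|f [H1 H2] x].
    by split=> x xA; have [h1 h2] := H x => //; exact: h1.
  by split=> [/H1//|]; exact: H2.
- move=> x; rewrite /delta0; split=> // xA; case: eqP => // x0.
  by rewrite x0 A0 in xA.
- move=> f a a0 Cf x; have [h1 h2] := Cf x.
  by split=> [/h1 fx|]; [rewrite pmulr_rle0|rewrite mulr_ge0 // ltW].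
Qed.

(** A minimiser for [Splus] also competes in [Sminus]. *)
Lemma lambda_minus_le_plus (A : {set G}) : 0 \in A ->
  lambda_minus R A <= lambda_plus R A.
Proof.
move=> A0; have [_] := lambda_minusP A A0; apply.
have [/quotientsP[f [[nz f0 fp] pf sf ->]] _] := lambda_plusP A A0.
by apply/quotientsP; exists f; split=> //; split=> // x /f0 ->.
Qed.

(* Since [f <= 0] off [A], only the term at 0 of [\sum_x f x * g x] can be
   positive, while Parseval bounds this sum from below. *)
Lemma lambda_minus_ge (A : {set G}) (g : G -> R) : 0 \in A ->
  (forall x, x != 0 -> x \in A -> g x = 0) -> (forall x, x != 0 -> 0 <= g x) ->
  posdef R G g -> 0 < g 0 ->
  (\sum_x g x) / (#|G|%:R * g 0) <= lambda_minus R A.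
Proof.
move=> A0 gA gp pg g0.
have [/quotientsP[f [[nz fA] pf sf ->]] _] := lambda_minusP A A0.
have q0 : 0 < #|G|%:R :> R by rewrite ltr0n card_zmod_gt0.
rewrite ler_pdivrMr ?mulr_gt0 // mulrAC ler_pdivlMr //.
rewrite mulrC; apply: le_trans (posdef_mul_sum _ _ _ _ pf pg) _.
rewrite mulrCA ler_pM2l // (bigD1 0) //= gerDl.
apply: sumr_le0 => x x0; have [xA|xA] := boolP (x \in A).
  by rewrite gA // mulr0.
by rewrite mulr_le0_ge0 ?fA ?gp.
Qed.

End Minimum.

(** * Deterministic bounds from small discrepancies *)

Section Pseudorandom.
Local Open Scope complex_scope.
Local Open Scope classical_set_scope.
Variables (R : realType) (G : finZmodType).
Variables (A : {set G}) (rho t : R).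
Hypotheses (stA : standard A) (rho01 : 0 < rho < 1).

(* The subtracted terms are the mean of the sum over a random standard set: it
   contains 0 surely and every other element with probability [rho]. *)
Definition discrepancy (gam : G -> R[i]) : R :=
  \sum_x Re (gam x) * (x \in A)%:R - rho * \sum_x Re (gam x) - (1 - rho).

Hypothesis discr : forall gam, character gam -> `|discrepancy gam| < t.

Let q0 : 0 < #|G|%:R :> R. Proof. by rewrite ltr0n card_zmod_gt0. Qed.

Let cardA1 : \sum_(x : G) 1 * (x \in A)%:R = #|A|%:R :> R.
Proof.
under eq_bigr do rewrite mul1r.
by rewrite -natr_sum -big_mkcond /= sum1_card.
Qed.

Let discr1 : `|#|A|%:R - rho * #|G|%:R - (1 - rho)| < t.
Proof.
have := discr _ (principal_character R G).
by rewrite /discrepancy /principal /= cardA1 sumr_const.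
Qed.

(** At the principal character the discrepancy differs from [#|A| - rho * #|G|] by [1 - rho], which
    lies between 0 and 1. *)
Lemma standard_card : `|#|A|%:R - rho * #|G|%:R| < t + 1.
Proof.
have /andP[r0 r1] := rho01; have := discr1.
by rewrite !ltr_norml => /andP[h1 h2]; apply/andP; split; lra.
Qed.

Let sum_mul_delta0 (h : G -> R) : \sum_x h x * (x == 0)%:R = h 0.
Proof.
by rewrite (bigD1 0) //= eqxx mulr1 big1 ?addr0 // => x /negPf ->; rewrite mulr0.
Qed.

Let Re_character0 (gam : G -> R[i]) : character gam -> Re (gam 0) = 1.
Proof. by move=> /character0 ->. Qed.

Lemma lambda_plus_lt : lambda_plus R A < (t + 1) / (rho * #|G|%:R).
Proof.
have [Ae A0] := stA; have /andP[r0 r1] := rho01; move: discr1.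
rewrite ltr_norml => /andP[h1 h2]; have t0 : 0 < t by lra.
have rq : 0 < rho * #|G|%:R by rewrite mulr_gt0.
(* At a nonprincipal character the transform of the indicator of [A] exceeds [(1 - rho) - t]; the
   mass added at 0 compensates exactly this. *)
pose f x : R := (x \in A)%:R + (t - (1 - rho)) * (x == 0)%:R.
have f0 : f 0 = t + rho by rewrite /f A0 eqxx /=; lra.
have sf (h : G -> R) : \sum_x h x * f x =
    \sum_x h x * (x \in A)%:R + h 0 * (t - (1 - rho)).
  rewrite -(sum_mul_delta0 (fun x => h x * (t - (1 - rho)))) -big_split /=.
  by apply: eq_bigr => x _; rewrite mulrDr mulrA.
have s1 : \sum_x f x = #|A|%:R + (t - (1 - rho)).
  have := sf (fun=> 1); under eq_bigr do rewrite mul1r.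
  by rewrite mul1r => ->; congr (_ + _); rewrite -cardA1.
have [_ lb] := lambda_plusP R G A A0.
apply: (@le_lt_trans _ _ (f 0 / \sum_x f x)).
  apply: lb; apply/quotientsP; exists f; split=> //; last by rewrite s1; lra.
    split; first by exists 0; rewrite f0 gt_eqF //; lra.
      move=> x xA; rewrite /f (negPf xA) add0r.
      by case: eqP => [x0|_]; [rewrite x0 A0 in xA|rewrite mulr0].
    move=> x xA; have [->|x0] := eqVneq x 0; first by rewrite f0; lra.
    by rewrite /f (negPf x0) mulr0 addr0.
  move=> gam cg; rewrite fourier_even //; last by move=> x; rewrite /f Ae oppr_eq0.
  rewrite ler0c; have [->|gne] := pselect (gam = @principal R G).
    by under eq_bigr do rewrite mul1r; rewrite s1; lra.
  have := discr _ cg; rewrite sf Re_character0 // /discrepancy.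
  by rewrite (character_Re_sum R G _ cg gne) ltr_norml => /andP[d1 d2]; lra.
(* The numerator [t + rho] is at most [t + 1], and the sum of [f] exceeds [rho * #|G|]. *)
rewrite f0 s1 ltr_pdivlMr // mulrAC ltr_pdivrMr; last by lra.
apply: (@le_lt_trans _ _ ((t + 1) * (rho * #|G|%:R))).
  by rewrite ler_pM2r //; lra.
by rewrite ltr_pM2l; lra.
Qed.

Lemma lambda_minus_gt : (1 - rho) / (t + 1) < lambda_minus R A.
Proof.
have [Ae A0] := stA; have /andP[r0 r1] := rho01; move: discr1.
rewrite ltr_norml => /andP[h1 h2]; have t0 : 0 < t by lra.
have rq : 0 < (1 - rho) * #|G|%:R by rewrite mulr_gt0 // subr_gt0.
(* At a nonprincipal character the indicator of the complement has transform above [-(1 + t - rho)],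
   which the mass at 0 offsets. *)
pose g x : R := 1 - (x \in A)%:R + (1 + t - rho) * (x == 0)%:R.
have g0 : g 0 = 1 + t - rho by rewrite /g A0 eqxx /=; lra.
have sg (h : G -> R) : \sum_x h x * g x =
    \sum_x h x - \sum_x h x * (x \in A)%:R + h 0 * (1 + t - rho).
  rewrite -(sum_mul_delta0 (fun x => h x * (1 + t - rho))) -sumrB -big_split /=.
  by apply: eq_bigr => x _; rewrite mulrDr mulrBr mulr1 mulrA.
have s1 : \sum_x g x = #|G|%:R - #|A|%:R + (1 + t - rho).
  have := sg (fun=> 1); under eq_bigr do rewrite mul1r.
  by rewrite mul1r => ->; congr (_ - _ + _); rewrite -?cardA1 // sumr_const.
have gx x : x != 0 -> g x = 1 - (x \in A)%:R.
  by move=> /negPf x0; rewrite /g x0 mulr0 addr0.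
apply: lt_le_trans (lambda_minus_ge R G A g A0 _ _ _ _).
- rewrite g0 s1 ltr_pdivrMr; last by lra.
  have qg : 0 < #|G|%:R * (1 + t - rho) by rewrite mulr_gt0 //; lra.
  rewrite mulrAC ltr_pdivlMr // mulrA.
  apply: (@le_lt_trans _ _ ((1 - rho) * #|G|%:R * (t + 1))).
    by rewrite ler_pM2l //; lra.
  by rewrite ltr_pM2r; lra.
- by move=> x x0 xA; rewrite gx // xA subrr.
- by move=> x x0; rewrite gx // subr_ge0; case: (x \in A).
- move=> gam cg; rewrite fourier_even //; last by move=> x; rewrite /g Ae oppr_eq0.
  rewrite ler0c; have [->|gne] := pselect (gam = @principal R G).
    by under eq_bigr do rewrite mul1r; rewrite s1; lra.
  have := discr _ cg; rewrite sg Re_character0 // /discrepancy.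
  by rewrite (character_Re_sum R G _ cg gne) ltr_norml => /andP[d1 d2]; lra.
- by rewrite g0; lra.
Qed.

End Pseudorandom.

(** * Chernoff bound for weighted Bernoulli sums *)

Section Chernoff.
Variable R : realType.

(** The quadratic times [expR (- y)] has derivative [y * (1/2 - 3/4 * y) * expR (- y)], with the
    sign of [y] up to [2/3]; hence its value is at least its value 1 at 0. *)
Lemma expR_le_quadratic (x : R) : x <= 2 / 3 -> expR x <= 1 + x + 3 / 4 * x ^+ 2.
Proof.
move=> x23; pose f (y : R) := (1 + y + 3 / 4 * y ^+ 2) * expR (- y).
pose df (y : R) := y * (1 / 2 - 3 / 4 * y) * expR (- y).
have fd (y : R) : is_derive y 1 f (df y).
  by apply: is_derive_eq; rewrite /df /GRing.scale /=; field.
have fc (a b : R) : {within `[a, b], continuous f}.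
  apply: continuous_subspaceT => z; apply/differentiable_continuous.
  exact/derivable1_diffP/ex_derive.
have f0 : f 0 = 1 by rewrite /f oppr0 expR0; ring.
suff : 1 <= f x.
  rewrite /f expRN ler_pdivlMr ?expR_gt0 // mul1r //.
have [x0|/ltW x0] := leP 0 x.
  have [c] := @MVT_segment R f df 0 x x0 (fun y _ => fd y) (fc 0 x).
  rewrite in_itv /= f0 subr0 => /andP[c0 cx] E; rewrite -subr_ge0 E.
  by rewrite mulr_ge0 // mulr_ge0 ?expR_ge0 // mulr_ge0 //; lra.
have [c] := @MVT_segment R f df x 0 x0 (fun y _ => fd y) (fc x 0).
rewrite in_itv /= f0 sub0r => /andP[c0 cx] E; rewrite -subr_le0 E.
rewrite mulr_le0_ge0 ?oppr_ge0 // mulr_le0_ge0 ?expR_ge0 // mulr_le0_ge0 //.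
lra.
Qed.

Variable I : finType.
Implicit Types (p a : I -> R) (b : {ffun I -> bool}).

Definition bernoulli_weight p b : R := \prod_i (if b i then p i else 1 - p i).

Lemma bernoulli_weight_ge0 p b : (forall i, 0 <= p i <= 1) ->
  0 <= bernoulli_weight p b.
Proof.
move=> p01; apply: prodr_ge0 => i _; have /andP[p0 p1] := p01 i.
by case: ifP => // _; rewrite subr_ge0.
Qed.

(** In the quadratic bounds for the two exponentials the linear terms cancel by centring and the
    squares combine to the variance [p * (1 - p)]. *)
Lemma bernoulli_mgf_le (p u : R) : 0 <= p <= 1 -> `|u| <= 2 / 3 ->
  p * expR (u * (1 - p)) + (1 - p) * expR (u * (0 - p)) <=
  expR (3 / 4 * u ^+ 2 * (p * (1 - p))).
Proof.
move=> /andP[p0 p1]; rewrite ler_norml => /andP[u1 u2].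
have e1 : expR (u * (1 - p)) <= 1 + u * (1 - p) + 3 / 4 * (u * (1 - p)) ^+ 2.
  by apply: expR_le_quadratic; nra.
have e2 : expR (u * (0 - p)) <= 1 + u * (0 - p) + 3 / 4 * (u * (0 - p)) ^+ 2.
  by apply: expR_le_quadratic; nra.
apply: le_trans (expR_ge1Dx _).
apply: le_trans (lerD (ler_wpM2l p0 e1) (ler_wpM2l _ e2)) _; first lra.
by rewrite le_eqVlt; apply/orP; left; apply/eqP; ring.
Qed.

(** Markov's inequality for the exponential moment, which factors over the coordinates. *)
Lemma chernoff p a (s t : R) : (forall i, 0 <= p i <= 1) -> 0 <= s ->
  (forall i, `|s * a i| <= 2 / 3) ->
  \sum_(b : {ffun I -> bool} | t <= \sum_i a i * ((b i)%:R - p i))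
    bernoulli_weight p b <=
  expR (3 / 4 * s ^+ 2 * \sum_i a i ^+ 2 * (p i * (1 - p i)) - s * t).
Proof.
move=> p01 s0 sa.
apply: (@le_trans _ _ (\sum_(b : {ffun I -> bool}) bernoulli_weight p b *
    expR (s * (\sum_i a i * ((b i)%:R - p i)) - s * t))).
  rewrite [leLHS]big_mkcond; apply: ler_sum => b _; case: ifP => [tb|_].
    rewrite ler_peMr ?bernoulli_weight_ge0 // -[leLHS]expR0 ler_expR.
    by rewrite subr_ge0 ler_wpM2l.
  by rewrite mulr_ge0 ?expR_ge0 ?bernoulli_weight_ge0.
rewrite expRD; under eq_bigr do rewrite expRD mulrA.
rewrite -mulr_suml ler_pM2r ?expR_gt0 //.
pose F i (j : bool) := (if j then p i else 1 - p i) * expR (s * a i * (j%:R - p i)).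
have -> : \sum_(b : {ffun I -> bool}) bernoulli_weight p b *
    expR (s * (\sum_i a i * ((b i)%:R - p i))) =
    \sum_(b : {ffun I -> bool}) \prod_i F i (b i).
  apply: eq_bigr => b _; rewrite mulr_sumr expR_sum -big_split /=.
  by apply: eq_bigr => i _; rewrite /F mulrA.
(* Independence: the sum over configurations of a product is the product of the coordinate sums. *)
rewrite -bigA_distr_bigA /= mulr_sumr expR_sum; apply: ler_prod => i _.
rewrite big_bool /F /=; apply/andP; split.
  have /andP[p0 p1] := p01 i.
  by rewrite addr_ge0 // mulr_ge0 ?expR_ge0 // subr_ge0.
by apply: le_trans (bernoulli_mgf_le _ _ (p01 i) (sa i)) _; rewrite exprMn -!mulrA.
Qed.

Lemma chernoff_norm p a (s t : R) : (forall i, 0 <= p i <= 1) -> 0 <= s ->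
  (forall i, `|s * a i| <= 2 / 3) ->
  \sum_(b : {ffun I -> bool} | t <= `|\sum_i a i * ((b i)%:R - p i)|)
    bernoulli_weight p b <=
  2 * expR (3 / 4 * s ^+ 2 * \sum_i a i ^+ 2 * (p i * (1 - p i)) - s * t).
Proof.
move=> p01 s0 sa.
have sa' i : `|s * - a i| <= 2 / 3 by rewrite mulrN normrN.
have := lerD (chernoff p a s t p01 s0 sa) (chernoff p (fun i => - a i) s t p01 s0 sa').
under [in X in _ <= _ + X]eq_bigr do rewrite sqrrN.
rewrite -mulr2n -[X in _ <= X]mulr_natl; apply: le_trans.
rewrite [leLHS]big_mkcond [X in _ <= X + _]big_mkcond [X in _ <= _ + X]big_mkcond.
rewrite -big_split /=; apply: ler_sum => b _.
rewrite (eq_bigr (fun i => - (a i * ((b i)%:R - p i)))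
  (F1 := fun i => - a i * _)); last first.
  by move=> i _; rewrite mulNr.
rewrite sumrN; have := bernoulli_weight_ge0 p b p01.
set z := \sum_i _; rewrite ler_normr.
by case: (t <= z); case: (t <= - z); rewrite /=; lra.
Qed.

End Chernoff.

(** * Random standard sets *)

Section StandardSums.
Local Open Scope complex_scope.
Local Open Scope classical_set_scope.
Variables (R : realType) (G : finZmodType) (G2 : {set G}).
Hypothesis hG2 : pair_representatives G2.
Local Notation G1 := (involutions G).

Lemma involutionsN (x : G) : (- x \in G1) = (x \in G1).
Proof. by rewrite !inE mulNrn oppr_eq0. Qed.

Lemma involutions0 : 0 \in G1.
Proof. by rewrite inE mul0rn. Qed.

Lemma pair_repN (y : G) : y \in G2 -> (y \notin G1) && (- y \notin G2).
Proof.
move=> yG2; have [dis xor] := hG2; have yG1 : y \notin G1 by rewrite (disjointFr dis).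
by rewrite yG1; have := xor y yG1; rewrite yG2; case: (- y \in G2).
Qed.

Lemma pair_rep_neq0 (y : G) : y \in G2 -> y != 0.
Proof.
by move=> /pair_repN/andP[+ _]; apply: contraNneq => ->; exact: involutions0.
Qed.

Lemma std_set_involution (xi : G -> bool) x : x \in G1 ->
  (x \in std_set_of G2 xi) = (x == 0) || xi x.
Proof.
move=> xG1; rewrite !inE; have := xG1; rewrite inE => -> /=.
rewrite orbC; case: bigcupP => //= -[y /andP[yG2 _]].
have /andP[yG1 _] := pair_repN _ yG2.
rewrite !inE => /orP[]/eqP xy; first by rewrite -xy xG1 in yG1.
by rewrite -involutionsN -xy xG1 in yG1.
Qed.

Lemma std_set_pair_rep (xi : G -> bool) y : y \in G2 ->
  (y \in std_set_of G2 xi) = xi y.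
Proof.
move=> yG2; have /andP[yG1 yN] := pair_repN _ yG2.
have y2 : (y *+ 2 == 0) = false by move: yG1; rewrite inE => /negPf.
rewrite !inE (negPf (pair_rep_neq0 _ yG2)) y2 /=.
apply/bigcupP/idP => [[z /andP[zG2 xiz]]|xiy]; last first.
  by exists y; rewrite ?yG2 // !inE eqxx.
rewrite !inE => /orP[/eqP -> //|/eqP yz].
by move: yN; rewrite yz opprK zG2.
Qed.

Lemma std_set_of_ext (xi eta : G -> bool) :
  (forall y, y \in G1 :|: G2 -> xi y = eta y) ->
  std_set_of G2 xi = std_set_of G2 eta.
Proof.
move=> E; apply/setP => x.
have [xG1|xG1] := boolP (x \in G1).
  by rewrite !std_set_involution // E // inE xG1.
have [xG2|xG2] := boolP (x \in G2).
  by rewrite !std_set_pair_rep // E // inE xG2 orbT.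
have NxG2 : - x \in G2 by have [_ /(_ x xG1)] := hG2; rewrite (negPf xG2).
have [eN _] := std_set_of_standard G2 xi; have [fN _] := std_set_of_standard G2 eta.
by rewrite -eN -fN !std_set_pair_rep // E // inE NxG2 orbT.
Qed.

(** The coefficient of the variable at [y] in the sum of an even [h] over the random set. A pair
    counts twice; 0 is left out since it always belongs to the set. *)
Definition pair_coef (h : G -> R) (y : G) : R :=
  if y \in G2 then 2 * h y else if (y \in G1) && (y != 0) then h y else 0.

Lemma pair_coef_out h y : y \notin G1 :|: G2 -> pair_coef h y = 0.
Proof. by rewrite inE negb_or /pair_coef => /andP[/negPf -> /negPf ->]. Qed.

Lemma sum_pair_coef (h : G -> R) : (forall x, h (- x) = h x) ->
  \sum_x h x = h 0 + \sum_y pair_coef h y.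
Proof.
move=> he; rewrite (bigID [in G1]) [in RHS](bigID [in G1]) /= addrA.
have G2G1 y : y \in G2 -> y \notin G1 by move=> /pair_repN/andP[].
congr (_ + _).
  have E : \sum_(i in G1 | i != 0) h i = \sum_(i in G1 | i != 0) pair_coef h i.
    apply: eq_bigr => x /andP[xG1 x0]; rewrite /pair_coef xG1 x0.
    by case: ifP => // /G2G1; rewrite xG1.
  rewrite (bigD1 0) ?involutions0 //= [in RHS](bigD1 0) ?involutions0 //= E.
  rewrite [pair_coef h 0]/pair_coef eqxx andbF.
  by case: ifP => [/pair_rep_neq0|_]; rewrite ?eqxx // add0r.
rewrite (bigID [in G2]) /= [in RHS](bigID [in G2]) /= [X in _ = _ + X]big1; last first.
  by move=> x /andP[/negPf xG1 /negPf xG2]; rewrite /pair_coef xG1 xG2.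
(* Negation carries the remaining elements, neither involutions nor in [G2], onto [G2]. *)
rewrite [X in _ + X](reindex_inj oppr_inj) /= addr0.
rewrite [X in _ + X](eq_bigl (fun x => (x \notin G1) && (x \in G2))) => [|x].
  rewrite -big_split /=; apply: eq_bigr => x /andP[_ xG2].
  by rewrite /pair_coef xG2 he mulr2n mulrDl mul1r.
rewrite involutionsN; have [//|xG1] /= := boolP (x \in G1).
by have [_ /(_ x xG1)] := hG2; case: (x \in G2); case: (- x \in G2).
Qed.

Lemma std_set_sum (xi : G -> bool) (h : G -> R) : (forall x, h (- x) = h x) ->
  \sum_x h x * (x \in std_set_of G2 xi)%:R =
  h 0 + \sum_y pair_coef h y * (xi y)%:R.
Proof.
move=> he; have [se s0] := std_set_of_standard G2 xi.
rewrite (sum_pair_coef (fun x => h x * (x \in std_set_of G2 xi)%:R)) => [|x].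
  rewrite s0 mulr1; congr (_ + _); apply: eq_bigr => y _; rewrite /pair_coef.
  case: ifP => [yG2|_]; first by rewrite std_set_pair_rep // mulrA.
  case: ifP => [/andP[yG1 y0]|_]; last by rewrite mul0r.
  by rewrite std_set_involution // (negPf y0).
by rewrite he se.
Qed.

(** The certain element 0 contributes 1, and [rho] times the full sum contributes [rho] at 0; the
    term [1 - rho] cancels both, leaving a centred sum. *)
Lemma discrepancy_std_set (xi : G -> bool) (rho : R) (gam : G -> R[i]) :
  character gam ->
  discrepancy R G (std_set_of G2 xi) rho gam =
  \sum_y pair_coef (fun x => Re (gam x)) y * ((xi y)%:R - rho).
Proof.
move=> cg; have he x : Re (gam (- x)) = Re (gam x) by exact: character_ReN.
rewrite /discrepancy (std_set_sum xi (fun x => Re (gam x))) //.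
rewrite (sum_pair_coef (fun x => Re (gam x))) // character0 //=.
under [in RHS]eq_bigr do rewrite mulrBr.
by rewrite sumrB -mulr_suml; ring.
Qed.

Lemma pair_coef_norm (h : G -> R) y : (forall x, `|h x| <= 1) ->
  `|pair_coef h y| <= 2.
Proof.
move=> h1; rewrite /pair_coef; case: ifP => _.
  by rewrite normrM ger0_norm // ler_piMr.
case: ifP => _; last by rewrite normr0.
by apply: le_trans (h1 y) _; lra.
Qed.

(** Each square is at most twice the coefficient for the constant 1: [4 = 2 * 2] on [G2], and
    [1 <= 2] on nonzero involutions. *)
Lemma sum_sqr_pair_coef (h : G -> R) : (forall x, `|h x| <= 1) ->
  \sum_y pair_coef h y ^+ 2 <= 2 * #|G|%:R.
Proof.
move=> h1.
have -> : #|G|%:R = \sum_(x : G) 1 :> R by rewrite sumr_const.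
rewrite (sum_pair_coef (fun=> 1)) //.
apply: (@le_trans _ _ (2 * \sum_y pair_coef (fun=> 1) y)); last lra.
rewrite mulr_sumr; apply: ler_sum => y _; rewrite /pair_coef.
have hy : h y ^+ 2 <= 1 by rewrite -real_normK ?num_real // exprn_ile1.
by case: ifP => _; [|case: ifP => _]; rewrite ?exprMn; lra.
Qed.

End StandardSums.

(** * The law of the random configuration *)

Section Law.
Variables (R : realType) (I : finType) (D : {set I}) (rho : R).
Variables (d : measure_display) (T : measurableType d) (P : probability T R).
Variable xi : I -> {RV P >-> bool}.
Hypothesis xi_indep : mutually_independent D xi.
Hypothesis xi_law : forall y, y \in D -> P (xi y @^-1` [set true]) = rho%:E.

(** Coordinates outside [D] are set to [false], matching the parameter 0 in [bias], so that the
    product law runs over all of [I]. *)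
Definition config (w : T) : {ffun I -> bool} := [ffun y => (y \in D) && xi y w].

Definition bias (y : I) : R := if y \in D then rho else 0.

Lemma measurable_xi y (B : set bool) : measurable (xi y @^-1` B).
Proof.
by rewrite -[X in measurable X]setTI; exact: measurable_funPT.
Qed.

Lemma xi_lawE y (b : bool) : y \in D ->
  P (xi y @^-1` [set b]) = (if b then rho else 1 - rho)%:E.
Proof.
move=> yD; case: b; first exact: xi_law.
rewrite (_ : _ @^-1` _ = ~` (xi y @^-1` [set true])).
  by rewrite probability_setC ?xi_law //; exact: measurable_xi.
by apply/seteqP; split => w /=; case: (xi y w).
Qed.

Lemma config_preimage (b : {ffun I -> bool}) : (forall y, b y -> y \in D) ->
  config @^-1` [set b] = \bigcap_(y in [set` D]) (xi y @^-1` [set b y]).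
Proof.
move=> bD; apply/seteqP; split => w /=.
  by move=> <- y /= yD; rewrite ffunE yD.
move=> H; apply/ffunP => y; rewrite ffunE.
have [yD|yD] := boolP (y \in D); first exact: H.
by apply/esym/negP => /bD; apply/negP.
Qed.

Lemma config_preimage0 (b : {ffun I -> bool}) y : b y -> y \notin D ->
  config @^-1` [set b] = set0.
Proof.
move=> bY yD; apply/seteqP; split=> // w /= E.
by move: bY; rewrite -E ffunE (negPf yD).
Qed.

Lemma measurable_config (b : {ffun I -> bool}) : measurable (config @^-1` [set b]).
Proof.
have [[y [bY yD]]|/forallNP H] := pselect (exists y, b y /\ y \notin D).
  by rewrite (config_preimage0 b y).
rewrite config_preimage; last first.
  by move=> y bY; apply: contrapT => /negP yD; apply: (H y).
by apply: fin_bigcap_measurable => // y _; exact: measurable_xi.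
Qed.

Lemma config_law (b : {ffun I -> bool}) :
  P (config @^-1` [set b]) = (bernoulli_weight R I bias b)%:E.
Proof.
rewrite /bernoulli_weight /bias.
have [[y [bY yD]]|/forallNP H] := pselect (exists y, b y /\ y \notin D).
  rewrite (config_preimage0 b y) // measure0 (bigD1 y) //= bY (negPf yD).
  by rewrite mul0r.
have bD y : b y -> y \in D.
  by move=> bY; apply: contrapT => /negP yD; apply: (H y).
rewrite config_preimage // xi_indep //.
rewrite (eq_bigr _ (fun y yD => xi_lawE y (b y) yD)) prodEFin; congr (_%:E).
rewrite big_mkcond /=; apply: eq_bigr => y _.
case: ifP => // yD; case: ifP => [/bD|_]; first by rewrite yD.
by rewrite subr0.
Qed.

(** The event is a finite disjoint union of measurable fibres of [config], so its probability is a
    finite sum of weights. *)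
Lemma config_event (Q : pred {ffun I -> bool}) :
  P [set w | Q (config w)] = (\sum_(b | Q b) bernoulli_weight R I bias b)%:E.
Proof.
pose r := [seq b <- enum {: {ffun I -> bool}} | Q b].
have -> : [set w | Q (config w)] = \bigcup_(b in [set` r]) (config @^-1` [set b]).
  apply/seteqP; split=> [w Qw|w [b /= + E]].
    by exists (config w) => //=; rewrite mem_filter Qw mem_enum.
  by rewrite mem_filter E => /andP[].
rewrite measure_fin_bigcup //.
- rewrite -fsbig_seq; last by rewrite filter_uniq // enum_uniq.
  rewrite (eq_bigr (fun b => (bernoulli_weight R I bias b)%:E)) => [|b _].
    by rewrite sumEFin big_filter big_enum_cond.
  exact: config_law.
- by move=> b c _ _ [w [/= <- <-]].
- by move=> b _; exact: measurable_config.
Qed.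

Lemma sum_bernoulli_weight (p : I -> R) : \sum_b bernoulli_weight R I p b = 1.
Proof.
rewrite /bernoulli_weight.
rewrite -(bigA_distr_bigA (fun i (j : bool) => if j then p i else 1 - p i)).
by rewrite big1 // => i _; rewrite big_bool /= addrC subrK.
Qed.

End Law.

(** * Numerical estimates for the deviation and the exponent *)

Section Numerics.
Variables (R : realType) (q : nat) (c rho : R).
Hypothesis q_gt0 : (0 < q)%N.
Hypothesis hc : 1 < c < q%:R / (32 * ln q%:R).
Hypothesis hrho : 16 * c * (ln q%:R / q%:R) < rho < 1 - 16 * c * (ln q%:R / q%:R).
Local Notation L := (ln q%:R : R).
Local Notation v := (rho * (1 - rho) * q%:R).
Local Notation t0 := (3 * Num.sqrt (c * rho * (1 - rho) * q%:R * L)).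

Lemma ln_q_gt0 : 0 < L.
Proof.
have /andP[c1 cq] := hc; have q1 : 1 <= q%:R :> R by rewrite ler1n.
rewrite lt0r ln_ge0 // andbT; apply: contraTneq cq => ->.
by rewrite mulr0 invr0 mulr0 -leNgt; lra.
Qed.

Lemma c_ln_q_lt : 32 * (c * L) < q%:R.
Proof.
have /andP[c1 cq] := hc; have L0 := ln_q_gt0.
by move: cq; rewrite ltr_pdivlMr ?mulr_gt0 // => h; lra.
Qed.

(** A bootstrap: [L > 0] gives [q >= 2], hence [L >= ln 2 >= 1/2], hence [q >= 16] by [c_ln_q_lt],
    which exceeds the bound [(27/16)^2] for [expR 1]. *)
Lemma ln_q_ge1 : 1 <= L.
Proof.
have /andP[c1 cq] := hc; have L0 := ln_q_gt0; have h := c_ln_q_lt.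
have q2 : 2 <= q%:R :> R.
  rewrite ler_nat ltn_neqAle q_gt0 andbT.
  by apply: contraTneq L0 => <-; rewrite ln1 ltxx.
have l2 : 1 / 2 <= L.
  have : ln (1 + - (1 / 2) : R) <= - (1 / 2) by apply: le_ln1Dx; lra.
  rewrite (_ : 1 + - (1 / 2) = 2^-1 :> R); last lra.
  rewrite lnV ?posrE // => l; have : ln 2 <= L by rewrite ler_ln ?posrE //; lra.
  lra.
have q16 : 16 <= q%:R :> R by nra.
rewrite -[leLHS]expRK ler_ln ?posrE ?expR_gt0 //; last lra.
have : expR (1 / 2) <= 1 + 1 / 2 + 3 / 4 * (1 / 2) ^+ 2 :> R.
  by apply: expR_le_quadratic; lra.
have := expR_gt0 (1 / 2 : R).
rewrite (_ : expR 1 = expR (1 / 2) * expR (1 / 2) :> R); last first.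
  by rewrite -expRD; congr expR; lra.
nra.
Qed.

Lemma rho_gt0_lt1 : 0 < rho < 1.
Proof.
have /andP[c1 cq] := hc; have L0 := ln_q_gt0; have /andP[r1 r2] := hrho.
have q0 : 0 < q%:R :> R by rewrite ltr0n.
have : 0 < 16 * c * (L / q%:R) by rewrite !mulr_gt0 ?invr_gt0 //; lra.
by move=> h; apply/andP; split; lra.
Qed.

(** With [del = 16 c L / q < 1/2], the product [rho * (1 - rho)] exceeds [del * (1 - del)], hence
    [del / 2]. *)
Lemma variance_gt : 8 * (c * L) < v.
Proof.
have /andP[c1 cq] := hc; have L0 := ln_q_gt0; have /andP[r1 r2] := hrho.
have q0 : 0 < q%:R :> R by rewrite ltr0n.
have h := c_ln_q_lt.
pose del := 16 * c * (L / q%:R); have dE : del * q%:R = 16 * (c * L).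
  by rewrite /del; field; rewrite gt_eqF.
have d12 : del < 1 / 2 by rewrite -(ltr_pM2r q0) dE; lra.
have d0 : 0 < del by rewrite /del !mulr_gt0 ?invr_gt0 //; lra.
have e : del / 2 < rho * (1 - rho).
  by move: r1 r2; rewrite -/del; nra.
by move: e; rewrite -(ltr_pM2r q0) mulrAC dE; lra.
Qed.

Lemma deviation_sqr : t0 ^+ 2 = 9 * (c * L) * v.
Proof.
have /andP[c1 cq] := hc; have L0 := ln_q_gt0; have vg := variance_gt.
rewrite exprMn sqr_sqrtr; first ring.
rewrite (_ : _ * L = (c * L) * v); last ring.
have cL : 0 < c * L by rewrite mulr_gt0 //; lra.
by rewrite mulr_ge0 //; lra.
Qed.

(** The lower bound makes the loss of 1 in [t0 - 1] affordable; the upper one keeps the exponents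
    within the range [2/3] of the Chernoff bound. *)
Lemma deviation_bounds : 8 <= t0 /\ t0 <= 9 / 8 * v.
Proof.
have /andP[c1 cq] := hc; have L1 := ln_q_ge1; have vg := variance_gt.
have tt := deviation_sqr; have tge : 0 <= t0 by rewrite mulr_ge0 // sqrtr_ge0.
have cL : 1 <= c * L by nra.
by split; rewrite -ler_sqr ?nnegrE // ?tt; nra.
Qed.

(* The Chernoff parameter [t0 / (4 v)] is close to the minimiser of the exponent
   for a sum of variance at most [2 v]. *)
Lemma exponent_le (S : R) : 0 <= S <= 2 * v ->
  3 / 4 * (t0 / (4 * v)) ^+ 2 * S - t0 / (4 * v) * (t0 - 1) <= - (9 / 8 * (c * L)).
Proof.
move=> /andP[S0 S1]; have /andP[c1 cq] := hc; have L1 := ln_q_ge1.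
have vg := variance_gt; have tt := deviation_sqr; have [t8 _] := deviation_bounds.
have cL : 1 <= c * L by nra.
have v0 : 0 < v by lra.
move: S1 vg tt t8 v0; move: t0 v => t V S1 vg tt t8 V0.
have vn : V != 0 by rewrite gt_eqF.
set s := t / (4 * V).
have s0 : 0 <= s by rewrite divr_ge0 //; lra.
have st : s * t = 9 / 4 * (c * L).
  by rewrite /s mulrAC -expr2 tt; field; rewrite vn.
have ss : s ^+ 2 * V = 9 / 16 * (c * L).
  have -> : s ^+ 2 * V = s * t / 4 by rewrite /s; field.
  by rewrite st; lra.
have h1 : s ^+ 2 * S <= s ^+ 2 * (2 * V) by rewrite ler_wpM2l // sqr_ge0.
(* The loss of 1 costs at most [s * t / 8]. The contributions [27/32], [-72/32] and [9/32] times
   [c * L] add up to [-9/8]. *)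
have h2 : s * 1 <= s * (t / 8) by rewrite ler_wpM2l //; lra.
nra.
Qed.

(** Together with [div_deviation], this turns the bounds of the deterministic part, taken at
    [t + 1 = t0], into those of the theorem. *)
Lemma deviation_div : t0 / (rho * q%:R) =
  3 * Num.sqrt (c * L) * Num.sqrt ((1 - rho) / (rho * q%:R)).
Proof.
have /andP[c1 cq] := hc; have L1 := ln_q_ge1; have /andP[r0 r1] := rho_gt0_lt1.
have q0 : 0 < q%:R :> R by rewrite ltr0n.
have rq : 0 < rho * q%:R by rewrite mulr_gt0.
have cL : 0 <= c * L by rewrite mulr_ge0; lra.
rewrite (_ : c * rho * (1 - rho) * q%:R * L =
    (c * L) * ((1 - rho) / (rho * q%:R)) * (rho * q%:R) ^+ 2); last first.
  by field; rewrite !gt_eqF.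
have y0 : 0 <= (1 - rho) / (rho * q%:R) by rewrite divr_ge0 //; lra.
rewrite sqrtrM; last by rewrite mulr_ge0.
rewrite sqrtr_sqr gtr0_norm // sqrtrM //; field.
by rewrite !gt_eqF.
Qed.

Lemma div_deviation : (1 - rho) / t0 =
  1 / (3 * Num.sqrt (c * L)) * Num.sqrt ((1 - rho) / (rho * q%:R)).
Proof.
have /andP[c1 cq] := hc; have L1 := ln_q_ge1; have /andP[r0 r1] := rho_gt0_lt1.
have q0 : 0 < q%:R :> R by rewrite ltr0n.
have rq : 0 < rho * q%:R by rewrite mulr_gt0.
have x0 : 0 < Num.sqrt (c * L) by rewrite sqrtr_gt0 mulr_gt0 //; lra.
set y := Num.sqrt ((1 - rho) / _).
have y0 : 0 < y by rewrite sqrtr_gt0 divr_gt0 // subr_gt0.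
have yy : y ^+ 2 * (rho * q%:R) = 1 - rho.
  rewrite sqr_sqrtr; last by rewrite divr_ge0 ?ltW // subr_gt0.
  by rewrite divfK // gt_eqF.
have -> : t0 = 3 * Num.sqrt (c * L) * y * (rho * q%:R).
  by rewrite -[_ * y]deviation_div divfK // gt_eqF.
by rewrite -yy; field; rewrite !gt_eqF.
Qed.

End Numerics.

Theorem theorem9p2 (R : realType) (G : finZmodType) (q : nat) (hq : #|G| = q)
    (c rho : R)
    (hc : 1 < c < q%:R / (32 * ln q%:R))
    (hrho : 16 * c * (ln q%:R / q%:R) < rho < 1 - 16 * c * (ln q%:R / q%:R))
    (G2 : {set G}) (hG2 : pair_representatives G2)
    (d : measure_display) (T : measurableType d) (P : probability T R)
    (xi : G -> {RV P >-> bool})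
    (xi_indep : mutually_independent (involutions G :|: G2)%SET xi)
    (xi_law : forall y, y \in (involutions G :|: G2)%SET ->
       P (xi y @^-1` [set true]) = rho%:E) :
  let RS := fun w : T => std_set_of G2 (fun y => xi y w) in
  let good := [set w : T |
    [/\ `| #|RS w|%:R - rho * q%:R | <
          3 * Num.sqrt (c * rho * (1 - rho) * q%:R * ln q%:R),
        1 / (3 * Num.sqrt (c * ln q%:R)) * Num.sqrt ((1 - rho) / (rho * q%:R))
          < lambda_minus R (RS w),
        lambda_minus R (RS w) <= lambda_plus R (RS w) &
        lambda_plus R (RS w)
          < 3 * Num.sqrt (c * ln q%:R) * Num.sqrt ((1 - rho) / (rho * q%:R))]]
  in
  ((1 - 2 * q%:R `^ (1 - c))%R%:E < P good)%E.
Proof.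
pose RS := fun w : T => std_set_of G2 (fun y => xi y w).
lazy zeta; set good := mkset _.
have q0 : (0 < q)%N by rewrite -hq card_zmod_gt0.
have r01 := rho_gt0_lt1 R q c rho q0 hc hrho.
have L1 := ln_q_ge1 R q c q0 hc.
have vg := variance_gt R q c rho q0 hc hrho.
have [t8 tv] := deviation_bounds R q c rho q0 hc hrho.
have plusE := deviation_div R q c rho q0 hc hrho.
have minusE := div_deviation R q c rho q0 hc hrho.
have expE := exponent_le R q c rho q0 hc hrho.
set t0 := 3 * Num.sqrt (c * rho * (1 - rho) * q%:R * ln q%:R)
  in t8 tv plusE minusE expE good *.
set v := rho * (1 - rho) * q%:R in vg tv expE.
pose D := (involutions G :|: G2)%SET.
pose p := bias R G D rho.
have p01 y : 0 <= p y <= 1.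
  have /andP[r0 r1] := r01; rewrite /p /bias.
  by case: ifP => _; apply/andP; split; lra.
have [chi dchi] := exists_dual_family R G; have [cchi _] := dchi.
pose Z (i : 'I_#|G|) (b : {ffun G -> bool}) : R :=
  \sum_y pair_coef R G G2 (fun x => Re (chi i x)) y * ((b y)%:R - p y).
(* The conclusion as a predicate on finite configurations, to which [config_event] applies. *)
pose Q (b : {ffun G -> bool}) : bool := `[< let A := std_set_of G2 b in
  [/\ `| #|A|%:R - rho * q%:R | < t0,
      (1 - rho) / t0 < lambda_minus R A,
      lambda_minus R A <= lambda_plus R A &
      lambda_plus R A < t0 / (rho * q%:R)] >].
have goodE : good = [set w | Q (config R G D d T P xi w)].
  have RSE w : std_set_of G2 (config R G D d T P xi w) = RS w.
    by apply: std_set_of_ext => // y yD; rewrite ffunE /D yD.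
  rewrite /good -plusE -minusE.
  by apply/seteqP; split=> w /=; rewrite /Q RSE => /asboolP.
have QZ b : (forall i, `|Z i b| < t0 - 1) -> Q b.
  move=> Zb; apply/asboolP; set A := std_set_of G2 b => /=.
  have stA : standard A := std_set_of_standard G2 b.
  have [_ A0] := stA.
  have discr gam : character gam -> `|discrepancy R G A rho gam| < t0 - 1.
    move=> cg; have [i <-] := dual_family_all R G chi gam dchi cg.
    rewrite discrepancy_std_set // (_ : \sum_y _ = Z i b) //.
    (* Outside [D] the bias is 0 instead of [rho], but the coefficient vanishes there. *)
    apply: eq_bigr => y _; rewrite /p /bias; case: ifP => // /negbT yD.
    by rewrite pair_coef_out // !mul0r.
  have t1 : t0 - 1 + 1 = t0 by lra.
  split.
  - by have := standard_card R G A rho (t0 - 1) r01 discr; rewrite t1 hq.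
  - by have := lambda_minus_gt R G A rho (t0 - 1) stA r01 discr; rewrite t1.
  - exact: lambda_minus_le_plus.
  - by have := lambda_plus_lt R G A rho (t0 - 1) stA r01 discr; rewrite t1 hq.
rewrite goodE (config_event R G D rho d T P xi xi_indep xi_law) lte_fin -/p.
have := sum_bernoulli_weight R G p; rewrite (bigID Q) /= => s1.
have w0 b : 0 <= bernoulli_weight R G p b by exact: bernoulli_weight_ge0.
have qR : 0 < q%:R :> R by rewrite ltr0n.
have v0 : 0 < v by have /andP[c1 _] := hc; nra.
pose s := t0 / (4 * v).
have s0 : 0 <= s by rewrite divr_ge0 //; lra.
have Zle i : \sum_(b | t0 - 1 <= `|Z i b|) bernoulli_weight R G p b <=
    2 * expR (- (9 / 8 * (c * ln q%:R))).
  have h1 x : `|Re (chi i x)| <= 1 by exact: character_Re_le1.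
  have sa y : `|s * pair_coef R G G2 (fun x => Re (chi i x)) y| <= 2 / 3.
    rewrite normrM ger0_norm //.
    (* Here [s * 2 = t0 / (2 v)], at most [9/16] by [tv]. *)
    apply: (@le_trans _ _ (s * 2)); first by rewrite ler_wpM2l // pair_coef_norm.
    by rewrite /s mulrAC ler_pdivrMr ?mulr_gt0 //; lra.
  apply: le_trans (chernoff_norm R G p _ s (t0 - 1) p01 s0 sa) _.
  rewrite ler_pM2l // ler_expR; apply: expE; apply/andP; split.
    apply: sumr_ge0 => y _; have /andP[p0 p1] := p01 y.
    by rewrite mulr_ge0 ?sqr_ge0 // mulr_ge0 // subr_ge0.
  have /andP[r0 r1] := r01.
  apply: (@le_trans _ _ (\sum_y pair_coef R G G2 (fun x => Re (chi i x)) y ^+ 2 *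
      (rho * (1 - rho)))).
    apply: ler_sum => y _; rewrite ler_wpM2l ?sqr_ge0 // /p /bias.
    by case: ifP => // _; rewrite mul0r mulr_ge0 // ltW // subr_gt0.
  rewrite -mulr_suml; have := sum_sqr_pair_coef R G G2 hG2 _ h1.
  rewrite hq => h2; rewrite (_ : 2 * v = 2 * q%:R * (rho * (1 - rho))); last first.
    by rewrite /v; ring.
  by rewrite ler_wpM2r // mulr_ge0 // ltW // subr_gt0.
have bad : \sum_(b | ~~ Q b) bernoulli_weight R G p b <=
    \sum_(i < #|G|) \sum_(b | t0 - 1 <= `|Z i b|) bernoulli_weight R G p b.
  under [leRHS]eq_bigr do rewrite big_mkcond.
  rewrite exchange_big [leLHS]big_mkcond /=; apply: ler_sum => b _.
  have ge0 i : 0 <= if t0 - 1 <= `|Z i b| then bernoulli_weight R G p b else 0.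
    by case: ifP.
  case: ifP => [nQ|_]; last by apply: sumr_ge0.
  (* Union bound: by [QZ], a failing configuration is counted for at least one [i]. *)
  have [i Zi] : exists i, t0 - 1 <= `|Z i b|.
    apply: contrapT => /forallNP H; move/negP: nQ; apply; apply: QZ => i.
    by rewrite ltNge; apply/negP/H.
  by rewrite (bigD1 i) //= Zi lerDl; apply: sumr_ge0 => j _; exact: ge0.
have tot : \sum_(b | ~~ Q b) bernoulli_weight R G p b <=
    q%:R * (2 * expR (- (9 / 8 * (c * ln q%:R)))).
  apply: le_trans bad _; apply: le_trans (ler_sum _ (fun i _ => Zle i)) _.
  by rewrite sumr_const card_ord hq [leRHS]mulr_natl.
(* As [2 q^(1 - c)] equals [2 q * expR (- (c * ln q))], the surplus factor [9/8] yields
   strictness. *)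
suff : q%:R * (2 * expR (- (9 / 8 * (c * ln q%:R)))) < 2 * q%:R `^ (1 - c).
  by move=> h; lra.
rewrite mulrCA ltr_pM2l // /powR gt_eqF // mulrBl mul1r expRD lnK ?posrE //.
rewrite ltr_pM2l // ltr_expR ltrN2.
have /andP[c1 _] := hc; have : 0 < c * ln q%:R :> R by rewrite mulr_gt0 //; lra.
lra.
Qed.
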